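(* If there exists an irreducible $(n,4)$-homogeneous subcube partition then $n=6$.
   Context: Subcubes of $\{0,1\}^n$ are identified with words in $\{0,1,*\}^n$; the codimension is the number of non-$*$ positions. A subcube partition of length $n$ is a partition of $\{0,1\}^n$ into subcubes; it is irreducible if no subset $G$ with $1<|G|<|F|$ has a union that is a subcube, and tight if for every coordinate $i$ some subcube $s$ has $s_i\ne*$. An $(n,k)$-homogeneous subcube partition is a tight subcube partition of length $n$ all of whose subcubes have codimension $k$. *)

(* Defs.v *)
From mathcomp Require Import all_boot.

Set Implicit Arguments.
Unset Strict Implicit.
Unset Printing Implicit Defensive.

Definition point (n : nat) := {ffun 'I_n -> bool}.

(* Words in {0,1,*}^n: [None] stands for the symbol *. *)
Definition word (n : nat) := {ffun 'I_n -> option bool}.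

Definition subcube (n : nat) (s : word n) : {set point n} :=
  [set x : point n | [forall i, (s i == None) || (s i == Some (x i))]].

Definition codim (n : nat) (s : word n) : nat := #|[set i | s i != None]|.

(* A family of subcubes is given by its set of words; this loses nothing since
   [subcube] is injective (see [subcube_inj]). *)
Definition subcube_partition (n : nat) (F : {set word n}) : bool :=
  partition [set subcube s | s in F] [set: point n].

Definition irreducible (n : nat) (F : {set word n}) : Prop :=
  forall G : {set word n}, G \subset F -> 1 < #|G| < #|F| ->
    ~ exists t : word n, \bigcup_(s in G) subcube s = subcube t.

Definition tight (n : nat) (F : {set word n}) : Prop :=
  forall i : 'I_n, exists2 s : word n, s \in F & s i != None.

Definition homogeneous_subcube_partition (n k : nat) (F : {set word n}) : Prop :=
  [/\ subcube_partition F, tight F & forall s : word n, s \in F -> codim s = k].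

Lemma subcube_inj (n : nat) : injective (@subcube n).
Proof.
move=> s t st.
have E (x : point n) : [forall i, (s i == None) || (s i == Some (x i))] =
           [forall i, (t i == None) || (t i == Some (x i))].
  by have /setP/(_ x) := st; rewrite !inE.
have aux (u v : word n) i :
    (forall x : point n, [forall j, (u j == None) || (u j == Some (x j))] ->
      [forall j, (v j == None) || (v j == Some (x j))]) ->
    (v i == None) || (v i == u i).
  move=> H; case vi: (v i) => [b|] //.
  pose x : point n := [ffun j => if u j is Some c then c else ~~ b].
  have /forallP /(_ i) : [forall j, (v j == None) || (v j == Some (x j))].
    apply: H; apply/forallP=> j; rewrite ffunE.
    by case: (u j) => [c|] //=.
  by rewrite vi ffunE /=; case: (u i) => [c|] //=; case: b {vi x}.
apply/ffunP=> i.
have := aux s t i (fun x => etrans (esym (E x))).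
have := aux t s i (fun x => etrans (E x)).
by case: (s i) => [a|]; case: (t i) => [b|] //= /eqP.
Qed.

(* Main.v *)
(* Let s be a subcube of the partition with support S. Counting points by parity
   on S shows that some subcube t of the partition has the same support and
   differs from s in an odd number of coordinates. This makes an exact-cover
   search small: repeatedly pick an uncovered point, branch over the subcubes s
   through it, add a partner t of s when none is present, and drop the branch as
   soon as some of the chosen subcubes tile a subcube of codimension 1, 2 or 3.
   Coordinates are introduced only when a subcube mentions them, and normalised
   by flipping, so a single finite search covers all n; each of its leaves has
   16 subcubes mentioning exactly 6 coordinates. *)

Require Import Defs.
From mathcomp Require Import all_boot.

Set Implicit Arguments.
Unset Strict Implicit.
Unset Printing Implicit Defensive.

(** * Volumes and disjointness in subcube partitions *)

Lemma in_subcube (n : nat) (s : word n) (x : point n) :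
  reflect (forall i b, s i = Some b -> x i = b) (x \in subcube s).
Proof.
rewrite inE; apply: (iffP forallP) => [H i b si | H i].
  by have := H i; rewrite si /= => /eqP[].
by case si: (s i) => [b|] //=; rewrite (H _ _ si) eqxx.
Qed.

Lemma card_subcube (n : nat) (s : word n) : #|subcube s| * 2 ^ codim s = 2 ^ n.
Proof.
have -> : #|subcube s| = \prod_(i < n) (if s i == None then 2 else 1).
  have -> : #|subcube s| =
      #|family (fun i => [pred b | (s i == None) || (s i == Some b)])|.
    by rewrite cardsE; apply: eq_card => x; rewrite !inE.
  rewrite card_family foldrE big_image /=; apply: eq_bigr => i _.
  case: (s i) => [b|] /=; last by rewrite -card_bool; apply: eq_card.
  by rewrite -(card1 b); apply: eq_card => c; rewrite !inE eq_sym.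
have -> : 2 ^ codim s = \prod_(i < n) (if s i != None then 2 else 1).
  rewrite -big_mkcond /= prod_nat_const /codim; congr (_ ^ _).
  by apply: eq_card => i; rewrite !inE.
rewrite -big_split /=; transitivity (\prod_(i < n) 2); last first.
  by rewrite prod_nat_const card_ord.
by apply: eq_bigr => i _; case: (s i).
Qed.

Lemma partition_cover (n : nat) (F : {set word n}) (x : point n) :
  subcube_partition F -> exists2 s, s \in F & x \in subcube s.
Proof.
move=> /and3P[/eqP cF _ _].
have : x \in cover [set subcube s | s in F] by rewrite cF inE.
by case/bigcupP=> _ /imsetP[s sF ->] xs; exists s.
Qed.

(** Otherwise the point that follows [s], and follows [t] where [s] is free, would lie in both
    subcubes. *)
Lemma partition_conflict (n : nat) (F : {set word n}) (s t : word n) :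
  subcube_partition F -> s \in F -> t \in F -> s != t ->
  exists i b, s i = Some b /\ t i = Some (~~ b).
Proof.
move=> /and3P[_ /trivIsetP tF _] sF tF' st.
case: (pickP [pred i | (s i != None) && (t i == omap negb (s i))]) => [i|no].
  by case/andP; case si: (s i) => [b|] // _ /eqP ti; exists i, b.
pose x : point n := [ffun i => odflt (odflt false (t i)) (s i)].
have dis : [disjoint subcube s & subcube t].
  apply: tF; rewrite ?imset_f //; apply/eqP => /subcube_inj e.
  by rewrite e eqxx in st.
have xs : x \in subcube s by apply/in_subcube => i b; rewrite ffunE => ->.
have xt : x \in subcube t.
  apply/in_subcube => i b ti; have := no i; rewrite ffunE /= ti.
  by case: (s i) => [[]|] //=; case: b {ti}.
by have := disjointFr dis xs; rewrite xt.
Qed.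

Lemma partition_card_bigcup (n : nat) (F G : {set word n}) :
  subcube_partition F -> G \subset F ->
  #|\bigcup_(s in G) subcube s| = \sum_(s in G) #|subcube s|.
Proof.
move=> pF GF; have /and3P[_ tF _] := pF.
have tG : trivIset [set subcube s | s in G].
  by apply: trivIsetS tF; apply: imsetS.
have := eqP tG; rewrite /cover big_imset /=; last by move=> ? ? _ _; apply: subcube_inj.
rewrite big_imset /=; last by move=> ? ? _ _; apply: subcube_inj.
by move=> ->.
Qed.

Lemma homogeneous_sum_card (n k : nat) (F G : {set word n}) :
  homogeneous_subcube_partition k F -> G \subset F ->
  #|\bigcup_(s in G) subcube s| * 2 ^ k = #|G| * 2 ^ n.
Proof.
case=> pF _ cF GF; rewrite (partition_card_bigcup pF GF) big_distrl /=.
rewrite -sum_nat_const; apply: eq_bigr => s sG.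
by rewrite -(card_subcube s) cF // (subsetP GF).
Qed.

Lemma homogeneous_card (n k : nat) (F : {set word n}) :
  homogeneous_subcube_partition k F -> #|F| = 2 ^ k.
Proof.
move=> hF; have := homogeneous_sum_card hF (subxx F).
have -> : \bigcup_(s in F) subcube s = [set: point n].
  apply/setP => x; rewrite inE; have [pF _ _] := hF.
  have [s sF xs] := partition_cover x pF.
  by apply/bigcupP; exists s.
rewrite cardsT card_ffun card_bool card_ord mulnC => /eqP.
by rewrite eqn_pmul2r ?expn_gt0 // => /eqP ->.
Qed.

(** The members of [G] lie in [t], are disjoint and have the total volume of [t], so they tile it;
    the bounds on [codim t] give [1 < #|G| < #|F|]. *)
Lemma irreducible_no_tiling (n k : nat) (F G : {set word n}) (t : word n) :
  homogeneous_subcube_partition k F -> irreducible F -> G \subset F ->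
  0 < codim t < k -> #|G| * 2 ^ codim t = 2 ^ k ->
  ~ (forall s, s \in G -> forall i, t i != None -> s i = t i).
Proof.
move=> hF irr GF /andP[t0 tk] card_eq sub.
apply: (irr G GF).
  rewrite (homogeneous_card hF) -card_eq.
  have G0 : 0 < #|G|.
    by rewrite lt0n; apply: contraTneq (expn_gt0 2 k) => G0; rewrite -card_eq G0.
  apply/andP; split; last by rewrite -{1}(muln1 #|G|) ltn_pmul2l // -(expn0 2) ltn_exp2l.
  rewrite ltnNge; apply/negP => G1.
  have : 2 ^ k <= 2 ^ codim t by rewrite -card_eq -{2}(mul1n (2 ^ codim t)) leq_mul2r G1 orbT.
  by rewrite leq_exp2l // leqNgt tk.
exists t; apply/eqP; rewrite eqEcard; apply/andP; split.
  apply/bigcupsP => s sG; apply/subsetP => x /in_subcube xs.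
  by apply/in_subcube => i b ti; apply: xs; rewrite (sub s sG i) ti.
rewrite -(leq_pmul2r (expn_gt0 2 k)) (homogeneous_sum_card hF GF).
by rewrite -(card_subcube t) -card_eq mulnCA.
Qed.

(** * Parity and the odd partner of a subcube *)

Definition flip (n : nat) (i : 'I_n) (x : point n) : point n :=
  [ffun j => if j == i then ~~ x j else x j].

Lemma flipK (n : nat) (i : 'I_n) : involutive (flip i).
Proof. by move=> x; apply/ffunP => j; rewrite !ffunE; case: eqP => //; rewrite negbK. Qed.

(** The word [s] serves as origin: the points of its own subcube are even. *)
Definition odd_from (n : nat) (s : word n) (x : point n) : bool :=
  odd #|[set i | (s i != None) && (s i != Some (x i))]|.

Lemma odd_from_flip (n : nat) (s : word n) (i : 'I_n) (x : point n) :
  s i != None -> odd_from s (flip i x) = ~~ odd_from s x.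
Proof.
move=> si; rewrite /odd_from (cardsD1 i) [in RHS](cardsD1 i) !inE !oddD.
set A := odd #|_|; set B := odd #|_|; have -> : A = B.
  congr odd; apply: eq_card => j; rewrite !inE ffunE.
  by case: eqP.
rewrite ffunE eqxx; case: (s i) si => // b _ /=.
by case: b; case: (x i); case: B.
Qed.

(* Points in cubes with support other than [supp s] are matched, across parity
   on [supp s], by flipping a coordinate of [supp s] that their cube leaves free.
   Hence the cubes with support [supp s] contain as many points of either
   parity, while each of them contains points of one parity only. *)
Lemma odd_partner (n k : nat) (F : {set word n}) (s : word n) :
  homogeneous_subcube_partition k.+1 F -> s \in F ->
  exists2 t, t \in F & (forall i, (s i == None) = (t i == None)) /\
    odd #|[set i | s i != t i]|.
Proof.
move=> [pF _ cF] sF.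
case: (pickP [pred t in F | [forall i, (s i == None) == (t i == None)] &&
    odd #|[set i | s i != t i]|]) => [t /and3P[tF /'forall_eqP st ot]|no].
  by exists t.
have [i0 si0] : exists i, s i != None.
  have : 0 < codim s by rewrite cF.
  by case/card_gt0P=> i; rewrite inE; exists i.
(* The member through [x]; since [F] covers, the default [s] is never reached. *)
pose cov x := odflt s [pick t in F | x \in subcube t].
have covP x : cov x \in F /\ x \in subcube (cov x).
  rewrite /cov; case: pickP => [t /andP[] //|none].
  by have [t tF xt] := partition_cover x pF; have := none t; rewrite /= tF xt.
have covE x t : t \in F -> x \in subcube t -> cov x = t.
  move=> tF xt; have [cF' xc] := covP x; apply/eqP/negPn/negP => ct.
  have [i [b [ci ti]]] := partition_conflict pF cF' tF ct.
  move/in_subcube/(_ _ _ ci): xc; move/in_subcube/(_ _ _ ti): xt => ->.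
  by case: b {ci ti}.
pose dir (t : word n) := odflt i0 [pick i | (s i != None) && (t i == None)].
pose A := [set x | [forall i, (s i == None) == (cov x i == None)]].
pose P (b : bool) := [set x | odd_from s x == b].
have dirP x : x \notin A -> s (dir (cov x)) != None /\ cov x (dir (cov x)) = None.
  rewrite /dir inE => nA; case: pickP => [i /andP[si /eqP ->] //|none].
  (* If [cov x] fixed the whole support of [s], equal codimensions would force equal supports. *)
  case/negP: nA; have [cF' _] := covP x.
  have sub : [set i | s i != None] \subset [set i | cov x i != None].
    apply/subsetP => i; rewrite !inE => si; have := none i.
    by rewrite si => /= /negbT.
  have eqS : [set i | s i != None] = [set i | cov x i != None].
    apply/eqP; rewrite eqEcard sub /=.
    by move: (cF _ sF) (cF _ cF'); rewrite /codim => -> ->.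
  apply/forallP => i; move/setP/(_ i): eqS; rewrite !inE.
  by case: (s i == None); case: (cov x i == None).
pose g x := flip (dir (cov x)) x.
have covg x : x \notin A -> cov (g x) = cov x.
  move=> nA; have [_ cd] := dirP x nA; have [cF' /in_subcube xc] := covP x.
  apply: covE => //; apply/in_subcube => i b ci; rewrite ffunE.
  by case: eqP ci => [->|_]; [rewrite cd | exact: xc].
have gA x : x \notin A -> g x \notin A by move=> nA; move: (nA); rewrite !inE covg.
(* With no odd partner available, every point of [A] is even. *)
have PA x : x \in A -> odd_from s x = false.
  rewrite inE => /forallP xA; have [cF' /in_subcube xc] := covP x.
  have := no (cov x); rewrite /= cF' /=.
  have -> /= : [forall i, (s i == None) == (cov x i == None)] by apply/forallP.
  move=> <-; congr odd; apply: eq_card => i; rewrite !inE.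
  have := eqP (xA i); case si: (s i) => [b|] //=; case ci: (cov x i) => [c|] //= _.
  by rewrite (xc _ _ ci).
have le01 : #|P false| <= #|P true|.
  rewrite -(card_imset _ (inv_inj (@flipK _ i0))); apply: subset_leq_card.
  apply/subsetP => _ /imsetP[x xP ->]; move: xP.
  by rewrite !inE odd_from_flip // => /eqP ->.
have P1A x : x \in P true -> x \notin A.
  by rewrite inE => /eqP ox; apply/negP => /PA; rewrite ox.
have inj_g : {in P true &, injective g}.
  move=> x y /P1A xA /P1A yA gxy.
  have cxy : cov x = cov y by rewrite -(covg _ xA) gxy covg.
  by move: gxy; rewrite /g cxy => /(inv_inj (@flipK _ _)).
(* [g] injects odd points into even ones but stays outside [A], so it misses the points of [s]; this
   contradicts [le01]. *)
have lt10 : #|P true| < #|P false|.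
  rewrite -(card_in_imset inj_g); apply: proper_card; apply/properP; split.
    apply/subsetP => _ /imsetP[x xP ->]; have [sd _] := dirP x (P1A x xP).
    by move: xP; rewrite !inE odd_from_flip // => /eqP ->.
  pose x : point n := [ffun i => odflt false (s i)].
  have xs : x \in subcube s by apply/in_subcube => i b; rewrite ffunE => ->.
  have xA : x \in A by rewrite inE (covE x s) //; apply/forallP => i.
  exists x; first by rewrite inE PA.
  by apply/imsetP => -[y yP xy]; have := gA y (P1A y yP); rewrite -xy xA.
by have := leq_ltn_trans le01 lt10; rewrite ltnn.
Qed.

(** * The executable search *)

Definition pattern := seq (option bool).

(** The conditionals cut evaluation short; [vm_compute] would evaluate both arguments of a boolean
    connective. *)
Fixpoint conflict (v w : pattern) : bool :=
  match v, w with
  | Some b :: v', Some c :: w' => if b (+) c then true else conflict v' w'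
  | _ :: v', _ :: w' => conflict v' w'
  | _, _ => false
  end.

Fixpoint sub_pattern (w t : pattern) : bool :=
  match w, t with
  | _ :: w', None :: t' => sub_pattern w' t'
  | Some b :: w', Some c :: t' => if b (+) c then false else sub_pattern w' t'
  | None :: _, Some _ :: _ => false
  | _, _ => true
  end.

(* [odd_apart b v w]: [v] and [w] have the same stars, and the parity of the
   number of positions where they differ is [b]. *)
Fixpoint odd_apart (b : bool) (v w : pattern) : bool :=
  match v, w with
  | [::], [::] => ~~ b
  | None :: v', None :: w' => odd_apart b v' w'
  | Some c :: v', Some d :: w' => odd_apart (b (+) (c (+) d)) v' w'
  | _, _ => false
  end.

Fixpoint flips (b : bool) (v : pattern) : seq pattern :=
  match v with
  | [::] => if b then [::] else [:: [::]]
  | None :: v' => map (cons None) (flips b v')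
  | Some c :: v' => map (cons (Some c)) (flips b v') ++
                    map (cons (Some (~~ c))) (flips (~~ b) v')
  end.

Fixpoint faces (y : seq bool) (m : nat) : seq pattern :=
  match y with
  | [::] => if m is 0 then [:: [::]] else [::]
  | b :: y' => map (cons None) (faces y' m) ++
      (if m is m'.+1 then map (cons (Some b)) (faces y' m') else [::])
  end.

Fixpoint coarsenings (w : pattern) : seq pattern :=
  match w with
  | [::] => [:: [::]]
  | None :: w' => map (cons None) (coarsenings w')
  | Some c :: w' => let l := coarsenings w' in
      map (cons None) l ++ map (cons (Some c)) l
  end.

Definition weight (t : pattern) : nat := count isSome t.

(* A subcube of codimension 1, 2 or 3 that is the union of members of [P], which
   all have codimension 4. *)
Definition tiled (u : nat) (P : seq pattern) (t : pattern) : bool :=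
  if (0 < weight t < 4) && (count (sub_pattern^~ t) P * 2 ^ weight t == 16)
  then (size t == u) && uniq P else false.

(** A tiling completed by adding [s] uses [s], so only subcubes containing that of [s] are
    tested. *)
Definition reducible (u : nat) (P : seq pattern) (s : pattern) : bool :=
  has (tiled u P) (coarsenings s).

(* Only a heuristic: [search] checks the returned point again, so nothing is
   proved about [uncovered]. *)
Fixpoint uncovered (P : seq pattern) (u : nat) : option (seq bool) :=
  if has (all (pred1 None)) P then None else
  if u is u'.+1 then
    let half b := uncovered
      [seq behead w | w <- P & head None w != Some (~~ b)] u' in
    if half false is Some y then Some (false :: y) else omap (cons true) (half true)
  else Some [::].

(* [P] lists the words found so far, restricted to the [u] coordinates they
   mention. A new word [s] through the uncovered point [y] uses [4 - k] known
   coordinates, with the values prescribed by [y], and [k] new ones, where its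
   values may be taken to be 0 after flipping coordinates. *)
Fixpoint search (fuel u : nat) (P : seq pattern) : bool :=
  if fuel is m.+1 then
    if uncovered P u is Some y then
      if (size y == u) && all (conflict (map Some y)) P then
        all (fun k =>
          let u' := u + k in
          let P' := [seq w ++ nseq k None | w <- P] in
          all (fun v =>
            let s := v ++ nseq k (Some false) in
            if ~~ all (conflict s) P' then true else
            let P1 := s :: P' in
            if reducible u' P1 s then true else
            if has (odd_apart true s) P' then search m u' P1 else
            all (fun t =>
              if ~~ all (conflict t) P' then true else
              let P2 := t :: P1 in
              if reducible u' P2 t then true else search m u' P2)
            (flips true s))
          (faces y (4 - k)))
        (iota 0 5)
      else false
    else [&& u == 6, size P == 16 & uniq P]
  else false.

(** Fuel 16 suffices: the first round adds two words, later ones at least one, disjointness allows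
    at most 16, and the leaf takes one more call. *)
Lemma search_ok : search 16 0 [::].
Proof. by vm_compute. Qed.

Lemma odd_apart_flips (b : bool) (v w : pattern) :
  odd_apart b v w -> w \in flips b v.
Proof.
elim: v w b => [|[c|] v IH] [|[d|] w] b //=; first by case: b.
  rewrite mem_cat => /IH; case: c; case: d => /= vw; apply/orP;
    rewrite ?addbF ?addbT in vw; [left | right | right | left];
    exact: map_f.
by move=> /IH; exact: map_f.
Qed.

(** * Translation between words and patterns *)

(* The coordinates [cs], in order of appearance, become 0, 1, 2, ...; the bits of
   [f] record which of them have been flipped. *)
Definition reify (n : nat) (cs : seq 'I_n) (f : point n) (s : word n) : pattern :=
  [seq omap (addb (f i)) (s i) | i <- cs].

Lemma size_reify (n : nat) (cs : seq 'I_n) (f : point n) (s : word n) :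
  size (reify cs f s) = size cs.
Proof. exact: size_map. Qed.

Lemma weight_reify (n : nat) (cs : seq 'I_n) (f : point n) (s : word n) :
  uniq cs -> (forall i, s i != None -> i \in cs) ->
  weight (reify cs f s) = codim s.
Proof.
move=> ucs sub; rewrite /weight /reify count_map /codim -size_filter.
rewrite -(card_uniqP (filter_uniq _ ucs)); apply: eq_card => i.
rewrite mem_filter !inE /=.
by case si: (s i) => [b|] //=; rewrite sub ?si.
Qed.

Lemma reify_conflict (n : nat) (cs : seq 'I_n) (f : point n) (s t : word n)
    (i : 'I_n) (b : bool) :
  i \in cs -> s i = Some b -> t i = Some (~~ b) ->
  conflict (reify cs f s) (reify cs f t).
Proof.
move=> ics si ti; elim: cs ics => //= j cs IH; rewrite inE => /predU1P[<-|/IH].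
  by rewrite si ti /=; case: (f i); case: b {si ti}.
by case: (s j) => [c|]; case: (t j) => [d|] //= ->; rewrite if_same.
Qed.

(** Used to see that the member through an uncovered point is not yet listed. *)
Lemma reify_no_conflict (n : nat) (cs : seq 'I_n) (f x : point n) (s : word n) :
  x \in subcube s ->
  ~~ conflict (map Some [seq f i (+) x i | i <- cs]) (reify cs f s).
Proof.
move=> /in_subcube xs; elim: cs => //= j cs IH.
by case sj: (s j) => [c|] //=; rewrite (xs _ _ sj) addbb.
Qed.

Lemma reify_faces (n : nat) (cs : seq 'I_n) (f x : point n) (s : word n) :
  x \in subcube s ->
  reify cs f s \in faces [seq f i (+) x i | i <- cs] (weight (reify cs f s)).
Proof.
move=> /in_subcube xs; elim: cs => //= j cs IH.
rewrite mem_cat; case sj: (s j) => [c|] /=.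
  by rewrite add1n (xs _ _ sj) map_f ?orbT.
by rewrite add0n map_f.
Qed.

Lemma odd_apart_reify (n : nat) (cs : seq 'I_n) (f : point n) (s t : word n) (b : bool) :
  (forall i, (s i == None) = (t i == None)) ->
  odd_apart b (reify cs f s) (reify cs f t) =
    (b == odd (count (fun i => s i != t i) cs)).
Proof.
move=> st; elim: cs b => [|j cs IH] b /=; first by case: b.
have := st j; case: (s j) => [c|]; case: (t j) => [d|] //= _.
by rewrite IH oddD oddb; case: b; case: c; case: d; case: (f j); case: (odd _).
Qed.

Lemma odd_apart_reify_card (n : nat) (cs : seq 'I_n) (f : point n) (s t : word n) :
  uniq cs -> (forall i, s i != None -> i \in cs) ->
  (forall i, (s i == None) = (t i == None)) ->
  odd_apart true (reify cs f s) (reify cs f t) = odd #|[set i | s i != t i]|.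
Proof.
move=> ucs sub st; rewrite odd_apart_reify // -size_filter.
rewrite -(card_uniqP (filter_uniq _ ucs)) eq_sym eqb_id; congr odd.
apply: eq_card => i; rewrite mem_filter !inE.
have [//|nst] := eqVneq (s i) (t i); apply: sub; apply: contra nst => si.
by have := st i; rewrite si (eqP si) => /esym /eqP ->.
Qed.

Definition unreify (n : nat) (cs : seq 'I_n) (f : point n) (t : pattern) : word n :=
  [ffun i => if i \in cs then omap (addb (f i)) (nth None t (index i cs)) else None].

Lemma unreifyK (n : nat) (cs : seq 'I_n) (f : point n) (t : pattern) :
  uniq cs -> size t = size cs -> reify cs f (unreify cs f t) = t.
Proof.
move=> ucs st; apply: (@eq_from_nth _ None); first by rewrite size_reify.
move=> j; rewrite size_reify => js.
have i0 : 'I_n by case: cs js {ucs st} => [|i ?].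
rewrite (nth_map i0) // ffunE mem_nth // index_uniq //.
by case: (nth None t j) => [b|] //=; rewrite addKb.
Qed.

Lemma unreify_supp (n : nat) (cs : seq 'I_n) (f : point n) (t : pattern) (i : 'I_n) :
  unreify cs f t i != None -> i \in cs.
Proof. by rewrite ffunE; case: ifP. Qed.

Lemma sub_pattern_reify (n : nat) (cs : seq 'I_n) (f : point n) (s t : word n) :
  sub_pattern (reify cs f s) (reify cs f t) ->
  {in cs, forall i, t i != None -> s i = t i}.
Proof.
elim: cs => //= j cs IH.
case tj: (t j) => [c|]; case sj: (s j) => [d|] //=.
- case: ifP => // cd /IH H i; rewrite inE => /predU1P[-> _|/H //].
  by rewrite tj sj; move: cd; case: (f j); case: (c); case: (d).
- by move=> /IH H i; rewrite inE => /predU1P[->|/H //]; rewrite tj.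
- by move=> /IH H i; rewrite inE => /predU1P[->|/H //]; rewrite tj.
Qed.

(** * Soundness of the search *)

Lemma reducible_sound (n : nat) (F : {set word n}) (cs : seq 'I_n) (f : point n)
    (ss : seq (word n)) (p : pattern) :
  homogeneous_subcube_partition 4 F -> irreducible F -> uniq cs ->
  {subset ss <= F} ->
  ~~ reducible (size cs) [seq reify cs f s | s <- ss] p.
Proof.
move=> hF irr ucs ssF; apply/hasPn => t _; rewrite /tiled.
case: ifP => // /andP[wt /eqP card_eq]; apply/negP => /andP[/eqP st uss].
pose t' := unreify cs f t.
have t'E : reify cs f t' = t by rewrite unreifyK.
have ct : codim t' = weight t.
  by rewrite -t'E weight_reify // => i; exact: unreify_supp.
pose G := [set s in ss | sub_pattern (reify cs f s) t].
have cG : #|G| = count (sub_pattern^~ t) [seq reify cs f s | s <- ss].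
  (* Distinct patterns come from distinct words, so counting patterns counts members of [G]. *)
  rewrite count_map -size_filter -(card_uniqP (filter_uniq _ (map_uniq uss))).
  by apply: eq_card => s; rewrite mem_filter !inE andbC.
apply: (irreducible_no_tiling (G := G) (t := t') hF irr); rewrite ?ct ?cG //.
  by apply/subsetP => s; rewrite inE => /andP[/ssF].
move=> s; rewrite inE => /andP[_]; rewrite -t'E => /sub_pattern_reify H i ti.
exact: H (unreify_supp ti) ti.
Qed.

(** [F] itself selects a path down the search tree: its members survive all pruning, and [ss] stays
    inside [F] until a leaf is reached. *)
Lemma search_sound (n : nat) (F : {set word n}) (m : nat) (cs : seq 'I_n)
    (f : point n) (ss : seq (word n)) :
  homogeneous_subcube_partition 4 F -> irreducible F -> uniq cs ->
  {subset ss <= F} -> (forall s i, s \in ss -> s i != None -> i \in cs) ->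
  search m (size cs) [seq reify cs f s | s <- ss] -> n = 6.
Proof.
move=> hF irr; have [pF tF cF] := hF.
elim: m cs f ss => // m IH cs f ss ucs ssF sub; rewrite /search -/search.
case: uncovered => [y|]; last first.
  move=> /and3P[/eqP cs6 /eqP]; rewrite size_map => s16 /map_uniq uss.
  (* At a leaf, 16 distinct members exhaust [F], and tightness makes [cs] the set of all
     coordinates. *)
  have ssE : ss =i F.
    have sz : size (enum F) <= size ss.
      by rewrite -cardE (homogeneous_card hF) s16.
    have sse : {subset ss <= enum F} by move=> s /ssF; rewrite mem_enum.
    by have [_ e] := uniq_min_size uss sse sz; move=> s; rewrite e mem_enum.
  have : cs =i 'I_n.
    move=> i; have [s sF si] := tF i; rewrite [RHS]inE.
    by apply: sub si; rewrite ssE.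
  by move/eq_card; rewrite card_ord (card_uniqP ucs) cs6.
case: ifP => // /andP[/eqP sy yss] /allP srch.
(* A point of the full cube that reads as [y] on [cs]; its other coordinates are arbitrary. *)
pose x : point n := [ffun i => f i (+) nth false y (index i cs)].
have yE : y = [seq f i (+) x i | i <- cs].
  apply: (@eq_from_nth _ false); rewrite ?size_map // => j; rewrite sy => js.
  have i0 : 'I_n by case: (cs) js => [|i ?].
  by rewrite (nth_map i0) // ffunE index_uniq // addKb.
have [s sF xs] := partition_cover x pF.
have nss : s \notin ss.
  apply: contraL (reify_no_conflict cs f xs) => sss; rewrite -yE negbK.
  by apply: (allP yss); exact: map_f.
pose new := [seq i <- enum 'I_n | (s i != None) && (i \notin cs)].
(* New coordinates are flipped exactly where [s] has a 1, so that [s] reads 0 there. *)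
pose f' : point n := [ffun i => if i \in cs then f i else s i == Some true].
pose cs' := cs ++ new.
have ucs' : uniq cs'.
  rewrite cat_uniq ucs filter_uniq ?enum_uniq // andbT /=.
  by apply/hasPn => i; rewrite mem_filter => /andP[/andP[]].
have scs' i : s i != None -> i \in cs'.
  by move=> si; rewrite mem_cat mem_filter mem_enum si andbT; case: (i \in cs).
have ff' w : reify cs f' w = reify cs f w.
  by apply/eq_in_map => i ics; rewrite ffunE ics.
have sE : reify cs' f' s = reify cs f s ++ nseq (size new) (Some false).
  rewrite [LHS]map_cat -[map _ cs]/(reify cs f' s) ff'; congr (_ ++ _).
  rewrite -(size_reify new f' s); apply/all_pred1P; rewrite all_map.
  apply/allP => i; rewrite mem_filter /= ffunE => /andP[/andP[si /negbTE ->] _].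
  by case: (s i) si => [[]|].
have wE w : w \in ss -> reify cs' f' w = reify cs f w ++ nseq (size new) None.
  move=> wss; rewrite [LHS]map_cat -[map _ cs]/(reify cs f' w) ff'; congr (_ ++ _).
  rewrite -(size_reify new f' w); apply/all_pred1P; rewrite all_map.
  apply/allP => i; rewrite mem_filter => /andP[/andP[_ ics] _] /=.
  by case wi: (w i) => [b|] //; rewrite (sub w) ?wi in ics.
have PE : [seq p ++ nseq (size new) None | p <- [seq reify cs f w | w <- ss]] =
          [seq reify cs' f' w | w <- ss].
  by rewrite -map_comp; apply/eq_in_map => w /wE.
have ws : weight (reify cs f s) + size new = 4.
  rewrite -(cF s sF) -(weight_reify f' ucs' scs') sE /weight count_cat.
  by rewrite count_nseq mul1n.
have conf w : w \in F -> w \notin ss -> (forall i, w i != None -> i \in cs') ->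
    all (conflict (reify cs' f' w)) [seq reify cs' f' v | v <- ss].
  move=> wF wss wcs'; apply/allP => _ /mapP[v vss ->].
  have wv : w != v by apply: contraNneq wss => ->.
  have [i [b [wi vi]]] := partition_conflict pF wF (ssF v vss) wv.
  have ics : i \in cs' by apply: wcs'; rewrite wi.
  exact: reify_conflict ics wi vi.
have size_cs' : size cs + size new = size cs' by rewrite size_cat.
have ss1F : {subset s :: ss <= F}.
  by move=> w; rewrite inE => /predU1P[->|/ssF].
have sub1 w i : w \in s :: ss -> w i != None -> i \in cs'.
  rewrite inE => /predU1P[->|wss wi]; first exact: scs'.
  by rewrite mem_cat (sub w i wss wi).
have kin : size new \in iota 0 5 by rewrite mem_iota /= add0n ltnS -ws leq_addl.
(* Follow the branch with [size new] new coordinates; by [ws] the known part of [s] has the weight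
   required by [faces]. *)
move/allP: (srch _ kin) => /(_ (reify cs f s)).
rewrite -{1}ws addnK yE PE -sE size_cs' => /(_ (reify_faces cs f xs)).
rewrite conf //= -map_cons (negbTE (reducible_sound f' _ hF irr ucs' ss1F)).
(* Either a partner is already listed, or the one given by parity is new and is added too. *)
case: ifP => [_|/hasPn no]; first exact: IH.
have [t tF' [st ot]] := odd_partner hF sF.
have oa : odd_apart true (reify cs' f' s) (reify cs' f' t).
  by rewrite odd_apart_reify_card.
have tss : t \notin ss by apply/negP => /(map_f (reify cs' f')) /no; rewrite oa.
have tcs' i : t i != None -> i \in cs' by rewrite -st => /scs'.
move/allP => /(_ _ (odd_apart_flips oa)).
rewrite conf //= -map_cons -map_cons.
have ss2F : {subset t :: s :: ss <= F}.
  by move=> w; rewrite inE => /predU1P[->|/ss1F].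
rewrite (negbTE (reducible_sound f' _ hF irr ucs' ss2F)).
apply: IH => // w i; rewrite inE => /predU1P[->|]; [exact: tcs' | exact: sub1].
Qed.

Theorem theorem2p61 (n : nat) :
  (exists F : {set word n},
      homogeneous_subcube_partition 4 F /\ irreducible F) ->
  n = 6.
Proof.
case=> F [hF irr].
apply: (search_sound (cs := [::]) (f := [ffun=> false]) (ss := [::]) hF irr) => //.
exact: search_ok.
Qed.
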